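(* Let $d,m\ge1$ be integers, let $(\mathbf{U}_0,\mathbf{U}_1)$ be a random vector in $\mathbb{R}^m\times\mathbb{R}^d$ with an absolutely continuous joint distribution, and let $B\subseteq\mathbb{R}^m$ be a Borel set with $\Pr(\mathbf{U}_0\in B)>0$. Let $\mathbf{A}=\mathbf{D}\mathbf{P}$, where $\mathbf{D}$ is an $m\times m$ diagonal matrix with positive diagonal elements and $\mathbf{P}$ is an $m\times m$ permutation matrix, and let $B_{\mathbf{A}}=\{\mathbf{A}\mathbf{x}\mid\mathbf{x}\in B\}$. Then $\Pr(\mathbf{A}\mathbf{U}_0\in B_{\mathbf{A}})=\Pr(\mathbf{U}_0\in B)$ and $\Pr(\mathbf{A}\mathbf{U}_0\in B_{\mathbf{A}}\mid\mathbf{U}_1=\mathbf{z})=\Pr(\mathbf{U}_0\in B\mid\mathbf{U}_1=\mathbf{z})$ for every $\mathbf{z}\in\mathbb{R}^d$; consequently $$f_{\mathbf{U}_1\mid\mathbf{U}_0\in B}(\mathbf{z})=f_{\mathbf{U}_1\mid\mathbf{A}\mathbf{U}_0\in B_{\mathbf{A}}}(\mathbf{z})\qquad\text{for all }\mathbf{z}\in\mathbb{R}^d.$$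
   Context: For a random vector $(\mathbf{V}_0,\mathbf{U}_1)$ in $\mathbb{R}^m\times\mathbb{R}^d$ with absolutely continuous joint distribution and a Borel set $C\subseteq\mathbb{R}^m$ with $\Pr(\mathbf{V}_0\in C)>0$, the selection density is $$f_{\mathbf{U}_1\mid\mathbf{V}_0\in C}(\mathbf{z})=f_{\mathbf{U}_1}(\mathbf{z})\,\frac{\Pr(\mathbf{V}_0\in C\mid\mathbf{U}_1=\mathbf{z})}{\Pr(\mathbf{V}_0\in C)},\qquad\mathbf{z}\in\mathbb{R}^d,$$ i.e. the density of the conditional distribution of $\mathbf{U}_1$ given $\mathbf{V}_0\in C$. A version of the conditional distribution of $\mathbf{U}_0$ given $\mathbf{U}_1=\mathbf{z}$ is fixed, and the conditional distribution of $\mathbf{A}\mathbf{U}_0$ given $\mathbf{U}_1=\mathbf{z}$ is its image under $\mathbf{x}\mapsto\mathbf{A}\mathbf{x}$. *)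

(* Defs.v *)
From HB Require Import structures.
From mathcomp Require Import all_boot all_order all_algebra.
From mathcomp Require Import all_classical all_reals all_analysis.
From mathcomp Require Import measurable_realfun.
Set Implicit Arguments.
Unset Strict Implicit.
Unset Printing Implicit Defensive.
Import Order.TTheory GRing.Theory Num.Theory.
Import numFieldNormedType.Exports.
Local Open Scope classical_set_scope.
Local Open Scope ring_scope.
Local Open Scope ereal_scope.

(* R^n is n.-tuple R; its measurable sets, generated by the coordinate
   projections, are the Borel sets of R^n. *)

Section lebesgue_tuple.
Context {R : realType}.

Definition tuple_cons n (p : R * n.-tuple R) : n.+1.-tuple R :=
  [the n.+1.-tuple R of p.1 :: p.2].

Lemma measurable_tuple_cons n : measurable_fun [set: R * n.-tuple R]
  (@tuple_cons n).
Proof. exact: measurable_cons. Qed.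

Section step.
Context n (mu : {sigma_finite_measure set (n.-tuple R) -> \bar R}).

Definition lebesgue_step : set (n.+1.-tuple R) -> \bar R :=
  pushforward ((@lebesgue_measure R) \x mu) (@tuple_cons n).

Let lebesgue_step0 : lebesgue_step set0 = 0.
Proof. by rewrite /lebesgue_step /pushforward preimage_set0 measure0. Qed.

Let lebesgue_step_ge0 A : 0 <= lebesgue_step A.
Proof. by rewrite /lebesgue_step /pushforward measure_ge0. Qed.

Let lebesgue_step_sigma_additive : semi_sigma_additive lebesgue_step.
Proof.
move=> F mF tF mUF; rewrite /lebesgue_step /pushforward preimage_bigcup.
apply: measure_semi_sigma_additive.
- by move=> k; rewrite -[X in measurable X]setTI; exact: measurable_tuple_cons.
- apply/trivIsetP => /= i j _ _ ij; rewrite -preimage_setI.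
  by move/trivIsetP : tF => /(_ _ _ _ _ ij) ->//; rewrite preimage_set0.
- rewrite -preimage_bigcup -[X in measurable X]setTI.
  exact: measurable_tuple_cons.
Qed.

HB.instance Definition _ := isMeasure.Build _ _ _ lebesgue_step
  lebesgue_step0 lebesgue_step_ge0 lebesgue_step_sigma_additive.

Let tuple_uncons (t : n.+1.-tuple R) : R * n.-tuple R :=
  (thead t, [tuple of behead t]).

Let tuple_consK : cancel (@tuple_cons n) tuple_uncons.
Proof.
by case=> x t; rewrite /tuple_uncons theadE; congr pair; exact: val_inj.
Qed.

Let measurable_tuple_uncons : measurable_fun setT tuple_uncons.
Proof.
apply/measurable_fun_pair; first exact: measurable_tnth.
exact: measurable_behead.
Qed.

Let lebesgue_step_sigma_finite : sigma_finite setT lebesgue_step.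
Proof.
have /sigma_finiteP[F [TF ndF Foo]] := sigma_finiteT (@lebesgue_measure R).
have /sigma_finiteP[G [TG ndG Goo]] := sigma_finiteT mu.
exists (fun k => tuple_uncons @^-1` (F k `*` G k)).
  rewrite -preimage_bigcup (_ : \bigcup_k _ = setT) ?preimage_setT//.
  rewrite -setXTT TF TG predeqE => -[x y]; split.
    by move=> [k _ []/= ? ?]; split; exists k.
  move=> [/= [k _ Fkx] [l _ Gly]]; exists (maxn k l) => //; split.
  - by move: x Fkx; exact/subsetPset/ndF/leq_maxl.
  - by move: y Gly; exact/subsetPset/ndG/leq_maxr.
move=> k; have [mF Fk] := Foo k; have [mG Gk] := Goo k; split.
  rewrite -[X in measurable X]setTI; apply: measurable_tuple_uncons => //.
  exact: measurableX.
rewrite /lebesgue_step /pushforward -comp_preimage.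
rewrite (_ : _ \o _ = id) ?preimage_id; last exact/funext/tuple_consK.
by rewrite product_measure1E// lte_mul_pinfty// ge0_fin_numE.
Qed.

HB.instance Definition _ := Measure_isSigmaFinite.Build _ _ _ lebesgue_step
  lebesgue_step_sigma_finite.

End step.

(* Lebesgue measure on R^n, as the iterated product of the one on R *)
Fixpoint lebesgue_tuple n : {sigma_finite_measure set (n.-tuple R) -> \bar R} :=
  match n with
  | 0%N => [the {sigma_finite_measure set (0.-tuple R) -> \bar R}
            of \d_([tuple] : 0.-tuple R)]
  | k.+1 => [the {sigma_finite_measure set (k.+1.-tuple R) -> \bar R}
             of lebesgue_step (lebesgue_tuple k)]
  end.

Lemma measurable_tuple_box n (A : 'I_n -> set R) :
  (forall i, measurable (A i)) ->
  measurable [set t : n.-tuple R | forall i, A i (tnth t i)].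
Proof.
move=> mA; rewrite (_ : [set _ | _] =
    \bigcap_(i in [set: 'I_n]) (@tnth n R ^~ i @^-1` A i)).
  apply: fin_bigcap_measurable => // i _.
  by rewrite -[X in measurable X]setTI; exact: measurable_tnth.
by apply/seteqP; split => [t tA i _|t tA i]; [exact: tA|exact: (tA i I)].
Qed.

Lemma lebesgue_tuple_box n (A : 'I_n -> set R) :
  (forall i, measurable (A i)) ->
  lebesgue_tuple n [set t | forall i, A i (tnth t i)] =
  \prod_(i < n) lebesgue_measure (A i).
Proof.
elim: n A => [A _|n IH A mA] /=.
  by rewrite big_ord0 diracE mem_set// => -[].
rewrite big_ord_recl -IH//.
pose B := [set t : n.-tuple R | forall i, A (lift ord0 i) (tnth t i)].
have mB : measurable B.
  exact: (@measurable_tuple_box n (fun i => A (lift ord0 i))).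
transitivity ((lebesgue_measure \x lebesgue_tuple n) (A ord0 `*` B)); last first.
  by rewrite (product_measure1E (@lebesgue_measure R) (lebesgue_tuple n)
    (mA ord0) mB).
rewrite /lebesgue_step /pushforward; congr (_ _).
apply/seteqP; split => -[x t] /=.
  move=> tA; split=> [|i]; first exact: (tA ord0).
  by have := tA (lift ord0 i); rewrite /tuple_cons/= tnthS.
move=> [xA tA] i; case: (unliftP ord0 i) => [j|] -> //.
by rewrite /tuple_cons/= tnthS.
Qed.

End lebesgue_tuple.

Section linear_map.
Context {R : realType} {m : nat}.

Definition mulmx_tuple (A : 'M[R]_m) (x : m.-tuple R) : m.-tuple R :=
  [tuple (A *m \col_j tnth x j)%R i ord0 | i < m].

Lemma measurable_mulmx_tuple (A : 'M[R]_m) :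
  measurable_fun [set: m.-tuple R] (mulmx_tuple A).
Proof.
apply/measurable_fun_tnthP => i.
rewrite [X in measurable_fun _ X](_ : _ =
    fun x => (\sum_(j < m) A i j * tnth x j)%R); last first.
  apply/funext => x /=; rewrite tnth_mktuple mxE.
  by apply: eq_bigr => j _; rewrite mxE.
apply: measurable_sum => j; apply: measurable_funM => //.
exact: measurable_tnth.
Qed.

HB.instance Definition _ (A : 'M[R]_m) :=
  isMeasurableFun.Build _ _ _ _ (mulmx_tuple A) (measurable_mulmx_tuple A).

Lemma mulmx_tupleM (A B : 'M[R]_m) (x : m.-tuple R) :
  mulmx_tuple (A *m B) x = mulmx_tuple A (mulmx_tuple B x).
Proof.
apply: eq_from_tnth => i; rewrite !tnth_mktuple -mulmxA.
suff -> : (\col_j tnth (mulmx_tuple B x) j = B *m \col_j tnth x j)%R by [].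
by apply/colP => j; rewrite mxE tnth_mktuple.
Qed.

Lemma mulmx_tuple1 (x : m.-tuple R) : mulmx_tuple 1%:M x = x.
Proof. by apply: eq_from_tnth => i; rewrite tnth_mktuple mul1mx mxE. Qed.

Lemma measurable_image_mulmx_tuple (A : 'M[R]_m) (B : set (m.-tuple R)) :
  A \in unitmx -> measurable B -> measurable (mulmx_tuple A @` B).
Proof.
move=> uA mB.
rewrite (_ : _ @` _ = mulmx_tuple (invmx A) @^-1` B); last first.
  apply/seteqP; split => [_ [x Bx <-]|y By]/=.
    by rewrite -mulmx_tupleM mulVmx// mulmx_tuple1.
  exists (mulmx_tuple (invmx A) y) => //.
  by rewrite -mulmx_tupleM mulmxV// mulmx_tuple1.
by rewrite -[X in measurable X]setTI; exact: measurable_mulmx_tuple.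
Qed.

End linear_map.

Section conditional.
Context {d d1 d2} {T : measurableType d} {T1 : measurableType d1}
  {T2 : measurableType d2} {R : realType} (P : probability T R).

(* k z C is a version of Pr(V \in C | U = z), defined for every z *)
Definition is_cond_distribution (V : {RV P >-> T2}) (U : {RV P >-> T1})
    (k : R.-pker T1 ~> T2) :=
  forall (C : set T2) (E : set T1), measurable C -> measurable E ->
  P (V @^-1` C `&` U @^-1` E) = \int[distribution P U]_(z in E) k z C.

Definition is_density (mu : {measure set T1 -> \bar R}) (U : {RV P >-> T1})
    (f : T1 -> R) :=
  [/\ measurable_fun [set: T1] f, (forall z, (0 <= f z)%R) &
      forall E, measurable E ->
        distribution P U E = \int[mu]_(z in E) (f z)%:E].

(* f_{U | V \in C}(z) = f(z) Pr(V \in C | U = z) / Pr(V \in C), where f is the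
   chosen density of U and k the chosen version of the law of V given U;
   probabilities are finite, so fine loses nothing *)
Definition selection_density (V : {RV P >-> T2}) (f : T1 -> R)
    (k : R.-pker T1 ~> T2) (C : set T2) (z : T1) : R :=
  (f z * (fine (k z C) / fine (P (V @^-1` C))))%R.

End conditional.

Section kernel_image.
Context {d d1 d2 d3} {T : measurableType d} {T1 : measurableType d1}
  {T2 : measurableType d2} {T3 : measurableType d3} {R : realType}.
Variables (k : R.-pker T1 ~> T2) (g : {mfun T2 >-> T3}).

Definition kimage (z : T1) : set T3 -> \bar R := pushforward (k z) g.

Let kimage0 z : kimage z set0 = 0.
Proof. exact: measure0. Qed.

Let kimage_ge0 z A : 0 <= kimage z A.
Proof. exact: measure_ge0. Qed.

Let kimage_sigma_additive z : semi_sigma_additive (kimage z).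
Proof. exact: measure_semi_sigma_additive. Qed.

HB.instance Definition _ z := isMeasure.Build _ _ _ (kimage z)
  (kimage0 z) (@kimage_ge0 z) (@kimage_sigma_additive z).

Let kimageM (z : T1) : {measure set T3 -> \bar R} := kimage z.

Let measurable_kimage U :
  measurable U -> measurable_fun [set: T1] (kimageM ^~ U).
Proof.
move=> mU; apply: (measurable_kernel k (g @^-1` U)).
exact: measurable_funPTI.
Qed.

HB.instance Definition _ := isKernel.Build _ _ T1 T3 R kimageM
  measurable_kimage.

Let kimage_prob z : kimageM z setT = 1.
Proof. exact: (@prob_kernel _ _ _ _ _ k z). Qed.

HB.instance Definition _ := Kernel_isProbability.Build _ _ T1 T3 R kimageM
  kimage_prob.

(* conditional distribution of g(V) given U: the image of that of V by g *)
Definition cond_image : R.-pker T1 ~> T3 := kimageM.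

Lemma is_cond_distribution_image (P : probability T R) (V : {RV P >-> T2})
    (U : {RV P >-> T1}) :
  is_cond_distribution V U k ->
  is_cond_distribution (P := P) (g \o V) U cond_image.
Proof.
move=> kP C E mC mE; rewrite -kP//.
exact: measurable_funPTI.
Qed.

End kernel_image.

(* Main.v *)
Require Import Defs.
From HB Require Import structures.
From mathcomp Require Import all_boot all_order all_algebra.
From mathcomp Require Import all_classical all_reals all_analysis.
Set Implicit Arguments.
Unset Strict Implicit.
Unset Printing Implicit Defensive.
Import Order.TTheory GRing.Theory Num.Theory.
Import numFieldNormedType.Exports.
Local Open Scope classical_set_scope.
Local Open Scope ring_scope.
Local Open Scope ereal_scope.

(** A positive diagonal matrix times a permutation matrix is invertible, so
    [x |-> A x] is injective and pulling [A(B)] back along it gives [B] again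
    ([preimage_image_mulmx_tuple]). Hence [A U0] lies in [A(B)] on exactly the
    outcomes for which [U0] lies in [B], and since the conditional law of [A U0]
    given [U1 = z] is the image of the fixed version for [U0], the same identity
    of sets gives the conditional equality at every [z], not merely almost every
    one. The selection densities are then built from the same three factors. *)

Lemma mulmx_tuple_inj (R : realType) (m : nat) (A : 'M[R]_m) :
  A \in unitmx -> injective (mulmx_tuple A).
Proof.
move=> uA; apply: (can_inj (g := mulmx_tuple (invmx A))) => x.
by rewrite -mulmx_tupleM mulVmx// mulmx_tuple1.
Qed.

Lemma preimage_image_mulmx_tuple (R : realType) (m : nat) (A : 'M[R]_m)
    (B : set (m.-tuple R)) :
  A \in unitmx -> mulmx_tuple A @^-1` (mulmx_tuple A @` B) = B.
Proof.
move=> /mulmx_tuple_inj injA; apply/seteqP; split; last exact: preimage_image.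
by move=> x [y By /injA <-].
Qed.

(** A diagonal matrix is triangular, so its determinant is the product of its
    diagonal entries. *)
Lemma unitmx_diag_pos (R : realType) (m : nat) (D : 'M[R]_m) :
  is_diag_mx D -> (forall i, (0 < D i i)%R) -> D \in unitmx.
Proof.
move=> /is_diag_mx_is_trig trigD Dpos.
rewrite unitmxE det_trig// unitfE gt_eqF//.
by apply: prodr_gt0 => i _; exact: Dpos.
Qed.

Theorem mainTheorem3 (R : realType) (d m : nat) (hd : (0 < d)%N) (hm : (0 < m)%N)
    (disp : measure_display) (Omega : measurableType disp)
    (P : probability Omega R)
    (U0 : {RV P >-> m.-tuple R}) (U1 : {RV P >-> d.-tuple R})
    (hac : pushforward P (fun w : Omega => (U0 w, U1 w)) `<<
           (lebesgue_tuple m \x lebesgue_tuple d))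
    (f1 : d.-tuple R -> R) (hf1 : is_density (lebesgue_tuple d) U1 f1)
    (k : R.-pker (d.-tuple R) ~> (m.-tuple R))
    (hk : is_cond_distribution U0 U1 k)
    (B : set (m.-tuple R)) (mB : measurable B)
    (hB : 0 < P (U0 @^-1` B))
    (D Q A : 'M[R]_m)
    (hD : is_diag_mx D) (hDpos : forall i, (0 < D i i)%R)
    (hQ : is_perm_mx Q) (hA : A = (D *m Q)%R) :
  let AU0 : {RV P >-> m.-tuple R} := mulmx_tuple A \o U0 in
  let BA := mulmx_tuple A @` B in
  let kA := cond_image k (mulmx_tuple A) in
  [/\ P (AU0 @^-1` BA) = P (U0 @^-1` B),
      (forall z : d.-tuple R, kA z BA = k z B) &
      (forall z : d.-tuple R,
         selection_density U0 f1 k B z = selection_density AU0 f1 kA BA z)].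
Proof.
move=> AU0 BA kA.
have uA : A \in unitmx.
  have /is_perm_mxP[s Qs] := hQ.
  by rewrite hA unitmx_mul unitmx_diag_pos//= Qs unitmx_perm.
have BAK : mulmx_tuple A @^-1` BA = B by exact: preimage_image_mulmx_tuple.
have P_BA : P (AU0 @^-1` BA) = P (U0 @^-1` B) by rewrite /AU0 comp_preimage BAK.
have kA_BA z : kA z BA = k z B.
  by rewrite -[in RHS]BAK.
by split=> // z; rewrite /selection_density kA_BA P_BA.
Qed.
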